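(* Let $(\mathcal{E},\mathcal{E}')$ be a nested pair of ellipses in the plane ($\mathcal{E}'$ inside $\mathcal{E}$, not necessarily concentric or axis-aligned) admitting a family of Poncelet triangles. Let $X_k$ be a triangle center which is stationary over this family, and let $\mathcal{X}=\alpha X_2+\beta X_3+\gamma X_k$ with constants $\alpha,\beta,\gamma\in\mathbb{C}$ not depending on the triangle. Suppose that the elliptical locus of $\mathcal{X}$ over the family is not degenerate. Then, as the vertices of the Poncelet triangles sweep the outer ellipse $\mathcal{E}$ monotonically, $\mathcal{X}$ sweeps its elliptical locus monotonically as well.
   Context: The plane is identified with $\mathbb{C}$, with a fixed origin, so that points can be linearly combined with complex coefficients. A Poncelet triangle of the pair $(\mathcal{E},\mathcal{E}')$ is a triangle with its three vertices on $\mathcal{E}$ and its three side lines tangent to $\mathcal{E}'$. By Poncelet's closure theorem, if one such triangle exists then every point of $\mathcal{E}$ is a vertex of exactly one such triangle; the resulting one-parameter family is the family of Poncelet triangles. A triangle center is a point assigned to each triangle, independently of the labelling of the vertices and compatibly with similarities of the plane; it is stationary over the family if it is the same point for all triangles of the family. $X_2$ denotes the barycenter (centroid) and $X_3$ the circumcenter. The locus of $\mathcal{X}$ is the set of its positions over the family; it is known to be an ellipse, possibly degenerate. It is called degenerate if one or both of its semi-axes are zero, i.e. if it is a segment or a single point. A point moves monotonically on an ellipse if it always travels in the same rotational sense (clockwise or counterclockwise), without stopping or reversing direction; the sense of $\mathcal{X}$ on its locus need not be the same as that of the vertices on $\mathcal{E}$. *)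

(* Defs.v *)
From HB Require Import structures.
From mathcomp Require Import all_boot all_order all_algebra all_fingroup.
From mathcomp Require Import all_classical all_reals all_analysis.
From mathcomp Require Import complex.

Set Implicit Arguments.
Unset Strict Implicit.
Unset Printing Implicit Defensive.

Import Order.TTheory GRing.Theory Num.Theory.
Import numFieldNormedType.Exports.

Local Open Scope classical_set_scope.
Local Open Scope complex_scope.
Local Open Scope ring_scope.

(* A possibly degenerate ellipse. The two semi-axes are not ordered, and      *)
(* circles are allowed.                                                       *)
Record ellipse (R : realType) := Ellipse {
  ellipse_center : R[i];
  ellipse_axis : R[i];
  semi_a : R;
  semi_b : R;
  axis_norm1 : `|ellipse_axis| = 1;
  semi_a_ge0 : 0 <= semi_a;
  semi_b_ge0 : 0 <= semi_b
}.

Definition degenerate (R : realType) (E : ellipse R) : Prop :=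
  semi_a E = 0 \/ semi_b E = 0.

Definition ellipse_point (R : realType) (E : ellipse R) (t : R) : R[i] :=
  ellipse_center E + ellipse_axis E * (semi_a E * cos t +i* (semi_b E * sin t)).

(* The derivative of [ellipse_point E] at [t].                                *)
Definition ellipse_velocity (R : realType) (E : ellipse R) (t : R) : R[i] :=
  ellipse_axis E * (- (semi_a E * sin t) +i* (semi_b E * cos t)).

Definition ellipse_curve (R : realType) (E : ellipse R) : set R[i] :=
  range (ellipse_point E).

(* The open region bounded by a non-degenerate ellipse.                       *)
Definition ellipse_inside (R : realType) (E : ellipse R) : set R[i] :=
  [set z | let u := (z - ellipse_center E) / ellipse_axis E in
           (complex.Re u / semi_a E) ^+ 2 + (complex.Im u / semi_b E) ^+ 2 < 1].

Definition nested (R : realType) (E E' : ellipse R) : Prop :=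
  [/\ ~ degenerate E, ~ degenerate E' &
      ellipse_curve E' `<=` ellipse_inside E].

(* For A <> B: the line AB goes through a point of E, in the direction of the *)
(* tangent to E at this point.                                                *)
Definition tangent_line (R : realType) (E : ellipse R) (A B : R[i]) : Prop :=
  exists t r s : R,
    ellipse_point E t = A + r%:C * (B - A) /\
    ellipse_velocity E t = s%:C * (B - A).

Definition vertices (R : realType) : Type := 'I_3 -> R[i].

Definition collinear (R : realType) (T : vertices R) : Prop :=
  exists A d : R[i], forall i, exists s : R, T i = A + s%:C * d.

Definition is_triangle (R : realType) (T : vertices R) : Prop := ~ collinear T.

Definition poncelet_family (R : realType) (E E' : ellipse R) :
    set (vertices R) :=
  [set T | [/\ is_triangle T,
               forall i, ellipse_curve E (T i) &
               forall i j, i != j -> tangent_line E' (T i) (T j)]].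

(* The maps z |-> a z + b and z |-> a z^* + b with a != 0 are the direct and  *)
(* the opposite similarities of the plane. The value of X on degenerate       *)
(* triangles is irrelevant.                                                   *)
Definition triangle_center (R : realType) (X : vertices R -> R[i]) : Prop :=
  [/\ forall (T : vertices R) (s : {perm 'I_3}), is_triangle T ->
        X (T \o s) = X T,
      forall (T : vertices R) (a b : R[i]), is_triangle T -> a != 0 ->
        X (fun i => a * T i + b) = a * X T + b &
      forall (T : vertices R) (a b : R[i]), is_triangle T -> a != 0 ->
        X (fun i => a * (T i)^* + b) = a * (X T)^* + b].

Definition barycenter (R : realType) (T : vertices R) : R[i] :=
  (\sum_(i < 3) T i) / 3%:R.

(* The point equidistant from the three vertices; it exists and is unique for *)
(* a non-degenerate triangle (otherwise the value is unspecified).            *)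
Definition circumcenter (R : realType) (T : vertices R) : R[i] :=
  xget 0 [set O : R[i] | forall i j, `|O - T i| = `|O - T j|].

Definition stationary (R : realType) (E E' : ellipse R)
    (X : vertices R -> R[i]) : Prop :=
  forall T1 T2, poncelet_family E E' T1 -> poncelet_family E E' T2 ->
    X T1 = X T2.

Definition locus (R : realType) (E E' : ellipse R) (X : vertices R -> R[i]) :
    set R[i] :=
  X @` poncelet_family E E'.

(* During the time interval I, the moving point P has a continuous strictly   *)
(* monotone angular position on E, increasing or decreasing according to the  *)
(* rotational sense of the motion.                                            *)
Definition moves_monotonically (R : realType) (I : interval R)
    (P : R -> R[i]) (E : ellipse R) : Prop :=
  exists theta : R -> R,
    [/\ {within [set` I], continuous theta},
        {in I &, {homo theta : s t / s < t}} \/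
        {in I &, {homo theta : s t /~ s < t}} &
        {in I, forall t, P t = ellipse_point E (theta t)}].

(* Main.v *)
(* An affine change of coordinates turns E into the unit circle; let f and g  *)
(* be the foci of the image of E', which lie in the open disc. The tangency   *)
(* condition for a chord z w of the circle is quadratic in w, so the product  *)
(* of its two roots shows that, for a Poncelet triangle z1, z2, z3,           *)
(*   l = z1 z2 z3 = z1 (z1 - f) (z1 - g) / ((1 - f^* z1) (1 - g^* z1)),       *)
(* a Blaschke product of z1, whose argument is a strictly increasing function *)
(* of the argument of z1. The three vertices are the roots of this equation   *)
(* for fixed l, so z1 + z2 + z3 = f + g + l f^* g^*. The fourth intersection  *)
(* of E with the circumcircle has a coordinate conjugate to l, which gives    *)
(* the circumcenter. Both X_2 and X_3, hence X, are therefore of the form     *)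
(* A + B l + C l^*. In the coordinates where L is the unit circle this        *)
(* trigonometric polynomial has modulus 1 at more than four values of l,      *)
(* which leaves only B l or C l^* with a coefficient of modulus 1.            *)

Require Import Defs.
From HB Require Import structures.
From mathcomp Require Import all_boot all_order all_algebra all_fingroup.
From mathcomp Require Import all_classical all_reals all_analysis.
From mathcomp Require Import complex.
From mathcomp Require Import ring lra.

Set Implicit Arguments.
Unset Strict Implicit.
Unset Printing Implicit Defensive.

Import Order.TTheory GRing.Theory Num.Theory.
Import numFieldNormedType.Exports.

Local Open Scope classical_set_scope.
Local Open Scope complex_scope.
Local Open Scope ring_scope.

(** Everything is reduced to the single unimodular parameter [l], the product of the three vertices
    in the coordinates where [E] is the unit circle. [poncelet_vertices] shows that [l] and the sum
    of the vertices are governed by two points [f], [g] of the open disc depending only on the pair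
    of ellipses, and that a lift of the argument of [l] is [product_arg f g], strictly increasing
    because Blaschke factors turn in the positive sense ([is_derive_blaschke_arg]).
    [barycenter_trig] and [circumcenter_trig] make both centers trigonometric polynomials of degree
    one in [l]; the stationary center only shifts the constant term ([locus_trig]). Such a
    polynomial parametrizes an ellipse, but a priori with an unrelated constant term. That the
    values lie on [L] forces, by [trig_on_circle], a pure rotation of [l] or of its conjugate, and
    this fixes the sense of the motion. *)

(** * Field identities for tangent chords and circles *)

(** The left-hand side of the conclusion is the second divided difference at [x], [y], [z] of the
    vanishing function. It annihilates [k * t - b] and sends [t ^+ 3], [t ^+ 2], [t^-1] to
    [x + y + z], [1], [(x * y * z)^-1]. *)
Lemma divided_difference_pole (F : fieldType) (a e k b d : F) (x y z : F) :
  x != y -> x != z -> y != z -> x != 0 -> y != 0 -> z != 0 ->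
  (forall t, t \in [:: x; y; z] ->
    a * t ^+ 3 - e * t ^+ 2 + k * t - b + d / t = 0) ->
  a * (x + y + z) - e + d / (x * y * z) = 0.
Proof.
move=> xy xz yz x0 y0 z0 h.
have hx := h x; have hy := h y; have hz := h z.
rewrite !inE !eqxx ?orbT in hx hy hz.
have /eqP : (a * (x + y + z) - e + d / (x * y * z)) =
  (a * x ^+ 3 - e * x ^+ 2 + k * x - b + d / x) / ((x - y) * (x - z)) +
  (a * y ^+ 3 - e * y ^+ 2 + k * y - b + d / y) / ((y - x) * (y - z)) +
  (a * z ^+ 3 - e * z ^+ 2 + k * z - b + d / z) / ((z - x) * (z - y)).
  field.
  rewrite !subr_eq0 x0 y0 z0 xy xz yz.
  by rewrite [z == x]eq_sym [z == y]eq_sym [y == x]eq_sym xy xz yz.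
by rewrite hx // hy // hz // !mul0r !addr0 => /eqP.
Qed.

(* Primed letters and [w1], [w2] are the complex conjugates of the unprimed   *)
(* ones and of [z1], [z2]; the chord from [z1] to [z2] has the equation       *)
(* [z + z1 z2 z' = z1 + z2], which expresses tangency at [c + u e + v / e] as *)
(* the vanishing of a discriminant.                                           *)
Lemma chord_tangentP (F : fieldType)
    (i c u v c' u' v' z1 z2 w1 w2 e e' r s : F) :
  i != 0 -> z1 * w1 = 1 -> z2 * w2 = 1 -> e * e' = 1 ->
  c + u * e + v * e' = z1 + r * (z2 - z1) ->
  c' + u' * e' + v' * e = w1 + r * (w2 - w1) ->
  i * (u * e - v * e') = s * (z2 - z1) ->
  - i * (u' * e' - v' * e) = s * (w2 - w1) ->
  (z1 + z2 - c - z1 * z2 * c') ^+ 2 =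
    4 * (u + z1 * z2 * v') * (v + z1 * z2 * u').
Proof.
move=> i0 zw1 zw2 ee h1 h2 h3 h4.
set M := u + _ * v'; set N := v + _ * u'.
have p1 : z1 * z2 * w1 = z2 by rewrite mulrAC zw1 mul1r.
have p2 : z1 * z2 * w2 = z1 by rewrite -mulrA zw2 mulr1.
have hs : z1 + z2 - c - z1 * z2 * c' = M * e + N * e'.
  have -> : z1 + z2 = (z1 + r * (z2 - z1)) + (z1 * z2) * (w1 + r * (w2 - w1)).
    by rewrite [z1 * z2 * (_ + _)]mulrDr mulrCA (mulrBr (z1 * z2)) p1 p2; ring.
  by rewrite -h1 -h2 /M /N; ring.
have hd : M * e = N * e'.
  apply/eqP; rewrite -subr_eq0 -(mulrI_eq0 _ (mulfI i0)); apply/eqP.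
  have -> : i * (M * e - N * e') =
    i * (u * e - v * e') + (z1 * z2) * (- i * (u' * e' - v' * e)).
    by rewrite /M /N; ring.
  by rewrite h3 h4 mulrCA (mulrBr (z1 * z2)) p1 p2; ring.
have -> : 4 * M * N = 4 * (M * e) * (N * e').
  by rewrite -(mulr1 (4 * M * N)) -ee; ring.
by rewrite hs hd; ring.
Qed.

(** Vieta: [z2] and [z3] are roots of one quadratic, whose constant and leading coefficients appear
    on the two sides. The form without division allows the leading coefficient to vanish. *)
Lemma tangent_chords_product (F : fieldType) (c u v c' u' v' z1 z2 z3 : F) :
  z2 != z3 ->
  (z1 + z2 - c - z1 * z2 * c') ^+ 2 =
    4 * (u + z1 * z2 * v') * (v + z1 * z2 * u') ->
  (z1 + z3 - c - z1 * z3 * c') ^+ 2 =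
    4 * (u + z1 * z3 * v') * (v + z1 * z3 * u') ->
  (z1 - c) ^+ 2 - 4 * u * v =
    z2 * z3 * ((1 - z1 * c') ^+ 2 - 4 * z1 ^+ 2 * u' * v').
Proof.
move=> z23 h2 h3.
pose q z := (z1 + z - c - z1 * z * c') ^+ 2 -
  4 * (u + z1 * z * v') * (v + z1 * z * u').
have q2 : q z2 = 0 by rewrite /q h2 subrr.
have q3 : q z3 = 0 by rewrite /q h3 subrr.
apply/eqP; rewrite -subr_eq0; apply/eqP.
have z32 : z3 - z2 != 0 by rewrite subr_eq0 eq_sym.
(* This combination of [q z2] and [q z3] eliminates the linear coefficient of [q]. *)
have -> : (z1 - c) ^+ 2 - 4 * u * v -
  z2 * z3 * ((1 - z1 * c') ^+ 2 - 4 * z1 ^+ 2 * u' * v') =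
  (z3 * q z2 - z2 * q z3) / (z3 - z2) by rewrite /q; field.
by rewrite q2 q3 !mulr0 subrr mul0r.
Qed.

(** Multiplying the relation of [tangent_chords_product] by the vertex gives the same cubic, with
    coefficients depending on [l], for all three vertices; their sum is read off its quadratic
    coefficient. *)
Lemma poncelet_vertex_sum (F : fieldType) (c u v c' u' v' z1 z2 z3 : F) :
  z1 != z2 -> z1 != z3 -> z2 != z3 -> z1 != 0 -> z2 != 0 -> z3 != 0 ->
  (forall x y, x \in [:: z1; z2; z3] -> y \in [:: z1; z2; z3] -> x != y ->
    (x + y - c - x * y * c') ^+ 2 = 4 * (u + x * y * v') * (v + x * y * u')) ->
  z1 + z2 + z3 = 2 * c + z1 * z2 * z3 * (c' ^+ 2 - 4 * u' * v').
Proof.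
move=> z12 z13 z23 z10 z20 z30 h.
set l := z1 * z2 * z3.
have hp x y z : x \in [:: z1; z2; z3] -> y \in [:: z1; z2; z3] ->
    z \in [:: z1; z2; z3] -> x != y -> x != z -> y != z -> x * y * z = l ->
    x * ((x - c) ^+ 2 - 4 * u * v) =
    l * ((1 - x * c') ^+ 2 - 4 * x ^+ 2 * u' * v').
  move=> hx hy hz xy xz yz <-.
  by rewrite (tangent_chords_product yz (h _ _ hx hy xy) (h _ _ hx hz xz)); ring.
have := @divided_difference_pole _ 1 (2 * c + l * (c' ^+ 2 - 4 * u' * v'))
  (c ^+ 2 - 4 * u * v + 2 * l * c') l 0 _ _ _ z12 z13 z23 z10 z20 z30.
rewrite mul1r mul0r addr0 => H; apply/eqP; rewrite -subr_eq0; apply/eqP/H => t.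
rewrite mul0r addr0 => ht.
have -> : 1 * t ^+ 3 - (2 * c + l * (c' ^+ 2 - 4 * u' * v')) * t ^+ 2 +
    (c ^+ 2 - 4 * u * v + 2 * l * c') * t - l =
    t * ((t - c) ^+ 2 - 4 * u * v) -
    l * ((1 - t * c') ^+ 2 - 4 * t ^+ 2 * u' * v') by ring.
apply/eqP; rewrite subr_eq0; apply/eqP.
move: ht; rewrite !inE => /or3P[] /eqP ->.
- by apply: (hp _ z2 z3); rewrite ?inE ?eqxx ?orbT.
- by apply: (hp _ z1 z3); rewrite ?inE ?eqxx ?orbT // 1?eq_sym // /l; ring.
- by apply: (hp _ z1 z2); rewrite ?inE ?eqxx ?orbT // 1?eq_sym // /l; ring.
Qed.

(* The circle of centre [o] through the points [p z + q / z] meets the        *)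
(* ellipse in four points; the fourth one has parameter [(z1 z2 z3)^-1].      *)
Lemma circumcenter_relation (F : fieldType) (p q o o' k z1 z2 z3 : F) :
  z1 != z2 -> z1 != z3 -> z2 != z3 -> z1 != 0 -> z2 != 0 -> z3 != 0 ->
  (forall z, z \in [:: z1; z2; z3] ->
     (p * z + q / z - o) * (p / z + q * z - o') = k) ->
  p * o' + q * o = p * q * (z1 + z2 + z3 + (z1 * z2 * z3)^-1).
Proof.
move=> z12 z13 z23 z10 z20 z30 h.
have := @divided_difference_pole _ (p * q) (p * o' + q * o)
  (p ^+ 2 + q ^+ 2 + o * o' - k) (q * o' + p * o) (p * q)
  _ _ _ z12 z13 z23 z10 z20 z30.
move=> H; apply/esym/eqP; rewrite -subr_eq0 mulrDr addrAC; apply/eqP/H => t ht.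
have t0 : t != 0 by move: ht; rewrite !inE => /or3P[] /eqP ->.
by rewrite -(h _ ht); field.
Qed.

(** * The unit circle and the argument of a Blaschke factor *)

Definition cis (R : realType) (t : R) : R[i] := cos t +i* sin t.

Lemma cisD (R : realType) (s t : R) : cis (s + t) = cis s * cis t.
Proof.
by rewrite /cis cosD sinD addrC [X in _ +i* X]addrC [X in X +i* _]addrC.
Qed.

Lemma cis_conj (R : realType) (t : R) : (cis t)^* = cis (- t).
Proof. by rewrite /cis cosN sinN. Qed.

Lemma mulcis_conj (R : realType) (t : R) : cis t * (cis t)^* = 1.
Proof. by rewrite cis_conj -cisD subrr /cis cos0 sin0. Qed.

Lemma cis_neq0 (R : realType) (t : R) : cis t != 0.
Proof.
by apply/eqP => h; have := mulcis_conj t; rewrite h mul0r => /esym/eqP; rewrite oner_eq0.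
Qed.

Lemma cisV (R : realType) (t : R) : (cis t)^-1 = (cis t)^*.
Proof. by apply: (mulfI (cis_neq0 t)); rewrite mulcis_conj divff ?cis_neq0. Qed.

Lemma cis_surj (R : realType) (z : R[i]) :
  z * z^* = 1 -> exists t, z = cis t.
Proof.
case: z => x y /eqP; rewrite eq_complex /= => /andP[/eqP h _].
have xy : x ^+ 2 + y ^+ 2 = 1 by rewrite -h; ring.
have x1 : -1 <= x <= 1.
  have y2 := sqr_ge0 y; apply/andP; split; nra.
have hs : sin (acos x) = `|y|.
  by rewrite sin_acos // -sqrtr_sqr; congr Num.sqrt; rewrite -xy; ring.
have [y0|y0] := leP 0 y.
- by exists (acos x); rewrite /cis acosK ?in_itv // hs ger0_norm.
- exists (- acos x); rewrite /cis cosN sinN acosK ?in_itv // hs ltr0_norm //.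
  by rewrite opprK.
Qed.

(* The Blaschke factor [(z - f) / (1 - f^* z)] at [z = cis t] is              *)
(* [cis t * (w^* / w)], and [w] has a positive real part when [|f| < 1].      *)
Definition blaschke_arg (R : realType) (f : R[i]) (t : R) : R :=
  let w := 1 - f^* * cis t in t - 2 * atan (complex.Im w / complex.Re w).

Lemma Re_blaschke_gt0 (R : realType) (f : R[i]) (t : R) :
  `|f| < 1 -> 0 < complex.Re (1 - f^* * cis t).
Proof.
move=> f1; have ft : `|f^* * cis t| < 1.
  rewrite normrM normcJ (_ : `|cis t| = 1) ?mulr1 //.
  by rewrite normcE mulcis_conj sqrtc1.
have := le_lt_trans (normc_ge_Re _) ft; rewrite ltcR raddfB /=.
by move=> /(le_lt_trans (ler_norm _)); rewrite subr_gt0.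
Qed.

Lemma blaschke_argE (R : realType) (f : R[i]) (t : R) : `|f| < 1 ->
  cis t - f = cis (blaschke_arg f t) * (1 - f^* * cis t).
Proof.
move=> f1; have := Re_blaschke_gt0 t f1; rewrite /blaschke_arg.
set w := 1 - _ => w0.
set a := atan _.
have ca0 : 0 < cos a by apply: cos_gt0_pihalf; rewrite atan_gtNpi2 atan_ltpi2.
have [r wE] : exists r : R, w = r%:C * cis a.
  exists (complex.Re w / cos a).
  have ta : sin a / cos a = complex.Im w / complex.Re w by rewrite -/(tan a) atanK.
  have sa : sin a = complex.Im w / complex.Re w * cos a by rewrite -ta divfK ?gt_eqF.
  rewrite /cis sa; case: (w) w0 => x y /= x0; apply/eqP; rewrite eq_complex /=.
  by apply/andP; split; apply/eqP; field; rewrite !gt_eqF.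
have -> : cis t - f = cis t * w^*.
  by rewrite /w rmorphB rmorph1 rmorphM /= conjCK mulrBr mulr1 mulrCA mulcis_conj mulr1.
have -> : t - 2 * a = t + (- a + - a) by ring.
rewrite {2}wE 2!cisD -!cis_conj wE rmorphM /= [_%:C^*]conjc_real.
rewrite -!mulrA; congr (_ * _); rewrite mulrC; congr (_ * _).
by rewrite [(cis a)^* * (r%:C * _)]mulrCA [(cis a)^* * cis a]mulrC mulcis_conj mulr1.
Qed.

(** The derivative is the Poisson kernel, [1 - |f|^2] divided by the squared modulus of
    [1 - f^* * cis t]; below, [D] and [N] are the real and imaginary parts of the latter. *)
Lemma is_derive_blaschke_arg (R : realType) (f : R[i]) (t : R) : `|f| < 1 ->
  exists2 d : R, 0 < d & is_derive t 1 (blaschke_arg f) d.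
Proof.
move=> f1; have f2 : complex.Re f ^+ 2 + complex.Im f ^+ 2 < 1.
  by rewrite -ltcR add_Re2_Im2 expr_lt1.
have := fun t => Re_blaschke_gt0 t f1.
rewrite /blaschke_arg; case: f f1 f2 => p q _ f2 D0; rewrite /= in f2.
pose N s : R := q * cos s - p * sin s; pose D s : R := 1 - p * cos s - q * sin s.
have wE s : 1 - (p +i* q)^* * cis s = D s +i* N s.
  by apply/eqP; rewrite eq_complex /= /D /N; apply/andP; split; apply/eqP; ring.
have {}D0 s : 0 < D s by have := D0 s; rewrite wE.
have -> : (fun s : R => s - 2 * atan (complex.Im (1 - (p +i* q)^* * cis s) /
    complex.Re (1 - (p +i* q)^* * cis s))) = (fun s : R => s - 2 * atan (N s / D s)).
  by apply/funext => s; rewrite wE.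
have dN : is_derive t 1 N (- q * sin t - p * cos t).
  by rewrite /N; apply: is_derive_eq; rewrite /GRing.scale /=; ring.
have dD : is_derive t 1 D (- N t).
  by rewrite /D; apply: is_derive_eq; rewrite /GRing.scale /= /N; ring.
have Dt0 : D t != 0 by rewrite gt_eqF.
have dV := is_deriveV Dt0 dD.
have dA := is_derive1_comp (is_derive1_atan _) (is_deriveM dN dV).
pose g s := atan (N s / D s).
have dg : is_derive t 1 g ((1 + (N t / D t) ^+ 2)^-1 *
    (N t ^+ 2 / D t ^+ 2 + (- q * sin t - p * cos t) / D t)).
  apply: (@is_derive_eq _ _ _ g _ _ _ _ dA).
  by rewrite /GRing.scale /=; congr (_ * _); field.
have ND0 : 0 < D t ^+ 2 + N t ^+ 2 by rewrite ltr_pwDl ?sqr_ge0 ?exprn_gt0.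
exists ((1 - (p ^+ 2 + q ^+ 2)) / (D t ^+ 2 + N t ^+ 2)).
  by rewrite divr_gt0 // subr_gt0.
rewrite -/g.
apply: is_derive_eq; rewrite /GRing.scale /=.
have hND : 1 + (N t / D t) ^+ 2 = (D t ^+ 2 + N t ^+ 2) / D t ^+ 2 by field.
rewrite hND invf_div; have h2 : D t ^+ 2 + N t ^+ 2 != 0 by rewrite gt_eqF.
have pq : p ^+ 2 + q ^+ 2 = (p * cos t + q * sin t) ^+ 2 + N t ^+ 2.
  rewrite -[LHS]mulr1 -(cos2Dsin2 t) /N; ring.
have -> : - q * sin t - p * cos t = - (p * cos t + q * sin t) by ring.
have DE : p * cos t + q * sin t = 1 - D t by rewrite /D; ring.
by rewrite pq DE; field; rewrite Dt0 h2.
Qed.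

Lemma blaschke_arg_lt (R : realType) (f : R[i]) : `|f| < 1 ->
  {homo blaschke_arg f : s t / s < t}.
Proof.
move=> f1 s t st.
apply: (@gtr0_derive1_lt_cc _ (blaschke_arg f) s t) => //.
- by move=> x _; have [d _ hd] := is_derive_blaschke_arg x f1; exact: ex_derive.
- move=> x _; have [d d0 hd] := is_derive_blaschke_arg x f1.
  by rewrite derive1E derive_val.
- apply: derivable_within_continuous => x _.
  by have [d _ hd] := is_derive_blaschke_arg x f1; exact: ex_derive.
- by rewrite in_itv /= lexx ltW.
- by rewrite in_itv /= lexx ltW.
Qed.

Lemma blaschke_arg_continuous (R : realType) (f : R[i]) : `|f| < 1 ->
  continuous (blaschke_arg f).
Proof.
move=> f1 x; have [d _ hd] := is_derive_blaschke_arg x f1.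
exact/differentiable_continuous/derivable1_diffP/ex_derive.
Qed.

(** * Non-degenerate triangles and their circumcenter *)

Lemma conj_real_complex (R : realType) (x : R) : (x%:C)^* = x%:C.
Proof. exact: conjc_real. Qed.

Lemma eq_norm (R : realType) (x y : R[i]) : x * x^* = y * y^* -> `|x| = `|y|.
Proof. by rewrite -!normCK => /eqP; rewrite eqrXn2 // => /eqP. Qed.

Lemma real_complexP (R : realType) (z : R[i]) : z^* = z -> exists r : R, z = r%:C.
Proof.
by move=> h; apply/complex_realP; rewrite CrealE h.
Qed.

(* [4 'i] times the signed area of the triangle.                              *)
Definition complex_cross (R : realType) (A B C : R[i]) : R[i] :=
  (B - A)^* * (C - A) - (B - A) * (C - A)^*.

Local Notation i0 := (ord0 : 'I_3).
Local Notation i1 := (lift ord0 ord0 : 'I_3).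
Local Notation i2 := (lift ord0 (lift ord0 ord0) : 'I_3).

Lemma forall_I3 (P : 'I_3 -> Prop) : P i0 -> P i1 -> P i2 -> forall i, P i.
Proof.
move=> h0 h1 h2 [[|[|[|//]]] hi].
- by rewrite (_ : Ordinal hi = i0) //; exact: val_inj.
- by rewrite (_ : Ordinal hi = i1) //; exact: val_inj.
- by rewrite (_ : Ordinal hi = i2) //; exact: val_inj.
Qed.

Lemma complex_cross_neq0 (R : realType) (T : vertices R) :
  is_triangle T -> complex_cross (T i0) (T i1) (T i2) != 0.
Proof.
move=> tT; apply/eqP; rewrite /complex_cross.
set b := T i1 - T i0; set c := T i2 - T i0 => /eqP; rewrite subr_eq0 => /eqP h.
apply: tT; exists (T i0).
have [b0|b0] := eqVneq b 0.
  exists c; apply: forall_I3.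
  - by exists 0; rewrite mul0r addr0.
  - by exists 0; rewrite mul0r addr0; apply/eqP; rewrite -subr_eq0 -/b b0.
  - by exists 1; rewrite mul1r /c addrC subrK.
have [r hr] : exists r : R, c / b = r%:C.
  apply: real_complexP; rewrite fmorph_div /=.
  have bJ : b^* != 0 by rewrite conjC_eq0.
  apply/eqP; rewrite eqr_div // -[_ * b]mulrC -h mulrC //.
exists b; apply: forall_I3.
- by exists 0; rewrite mul0r addr0.
- by exists 1; rewrite mul1r /b addrC subrK.
- by exists r; rewrite -hr divfK // /c addrC subrK.
Qed.

Lemma triangle_inj (R : realType) (T : vertices R) : is_triangle T -> injective T.
Proof.
move=> /complex_cross_neq0; rewrite /complex_cross => /eqP h i j Tij.
apply/eqP; apply: contraT => ij; exfalso; apply: h; move: i j Tij ij.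
have aux : forall a b c : R[i], a = b \/ a = c \/ b = c ->
    (b - a)^* * (c - a) - (b - a) * (c - a)^* = 0.
  move=> a b c [->|[->|->]].
  - by rewrite subrr rmorph0 !mul0r subrr.
  - by rewrite subrr rmorph0 !mulr0 subrr.
  - by rewrite mulrC subrr.
apply: forall_I3; apply: forall_I3 => // h _; apply: aux; have := esym h; tauto.
Qed.

Lemma circumcenter_origin (R : realType) (b c : R[i]) : b^* * c - b * c^* != 0 ->
  exists o, `|o - b| = `|o| /\ `|o - c| = `|o|.
Proof.
move=> D0; have D0' : b * c^* - b^* * c != 0 by rewrite -oppr_eq0 opprB.
(* Cramer's rule for the equations [o * b^* + o^* * b = b * b^*] and [o * c^* + o^* * c = c * c^*]
   of the perpendicular bisectors. *)
pose o := (b * b^* * c - c * c^* * b) / (b^* * c - b * c^*).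
have oJ : o^* = (b^* * b * c^* - c^* * c * b^*) / (b * c^* - b^* * c).
  by rewrite fmorph_div /= !rmorphB !rmorphM /= !conjCK.
by exists o; split; apply: eq_norm; rewrite rmorphB /= oJ /o; field; rewrite D0 D0'.
Qed.

Lemma circumcenterP (R : realType) (T : vertices R) : is_triangle T ->
  forall i j, `|circumcenter T - T i| = `|circumcenter T - T j|.
Proof.
move=> /complex_cross_neq0 /circumcenter_origin[m [mb mc]].
have : exists O, [set O : R[i] | forall i j, `|O - T i| = `|O - T j|] O.
  suff H i : `|T i0 + m - T i| = `|m| by exists (T i0 + m) => i j; rewrite !H.
  move: i; apply: forall_I3; first by rewrite addrAC subrr add0r.
  - by rewrite -mb; congr Num.norm; ring.
  - by rewrite -mc; congr Num.norm; ring.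
by move=> /(xgetPex 0).
Qed.

(** * Affine coordinates in which an ellipse is the unit circle *)

(** The linear part of the coordinate change is kept apart because tangent vectors are transformed
    by it alone. *)
Definition unit_linear (R : realType) (E : ellipse R) (d : R[i]) : R[i] :=
  let w := d / ellipse_axis E in
  complex.Re w / semi_a E +i* (complex.Im w / semi_b E).

Definition unit_coord (R : realType) (E : ellipse R) (z : R[i]) : R[i] :=
  unit_linear E (z - ellipse_center E).

Lemma axis_neq0 (R : realType) (E : ellipse R) : ellipse_axis E != 0.
Proof. by rewrite -normr_eq0 axis_norm1 oner_eq0. Qed.

Lemma nondegenerateP (R : realType) (E : ellipse R) : ~ degenerate E ->
  0 < semi_a E /\ 0 < semi_b E.
Proof.
move=> h; rewrite !lt0r semi_a_ge0 semi_b_ge0 !andbT.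
by split; apply/eqP => h0; apply: h; [left|right].
Qed.

Lemma unit_linearE (R : realType) (E : ellipse R) :
  exists P Q : R[i], forall d, unit_linear E d = P * d + Q * d^*.
Proof.
exists ((((semi_a E)^-1 + (semi_b E)^-1) / 2)%:C / ellipse_axis E).
exists ((((semi_a E)^-1 - (semi_b E)^-1) / 2)%:C / (ellipse_axis E)^*) => d.
rewrite -[X in X + _]mulrA -[X in _ + X]mulrA [_^-1 * d]mulrC.
rewrite [_^-1 * d^*]mulrC -fmorph_div /unit_linear /=.
case: (d / ellipse_axis E) => x y /=; apply/eqP; rewrite eq_complex /=.
move: (semi_a E)^-1 (semi_b E)^-1 => a b.
by apply/andP; split; apply/eqP; field.
Qed.

Lemma ellipse_pointE (R : realType) (E : ellipse R) (t : R) :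
  ellipse_point E t = ellipse_center E + ellipse_axis E *
    (((semi_a E + semi_b E) / 2)%:C * cis t +
     ((semi_a E - semi_b E) / 2)%:C * (cis t)^*).
Proof.
rewrite /ellipse_point; congr (_ + _ * _); apply/eqP; rewrite eq_complex /=.
by apply/andP; split; apply/eqP; field.
Qed.

Lemma ellipse_velocityE (R : realType) (E : ellipse R) (t : R) :
  ellipse_velocity E t = 'i * (ellipse_axis E *
    (((semi_a E + semi_b E) / 2)%:C * cis t -
     ((semi_a E - semi_b E) / 2)%:C * (cis t)^*)).
Proof.
rewrite /ellipse_velocity mulrCA; congr (_ * _); apply/eqP; rewrite eq_complex /=.
by apply/andP; split; apply/eqP; field.
Qed.

Lemma unit_coord_point (R : realType) (E : ellipse R) (t : R) :
  ~ degenerate E -> unit_coord E (ellipse_point E t) = cis t.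
Proof.
move=> /nondegenerateP[a0 b0].
rewrite /unit_coord /unit_linear /ellipse_point addrAC subrr add0r.
rewrite mulrAC divff ?axis_neq0 // mul1r /= /cis.
by congr (_ +i* _); rewrite mulrAC divff ?mul1r // gt_eqF.
Qed.

Lemma eq_cis_point (R : realType) (E : ellipse R) (s t : R) :
  cis s = cis t -> ellipse_point E s = ellipse_point E t.
Proof. by rewrite /ellipse_point => -[-> ->]. Qed.

Lemma norm_unit_coord (R : realType) (E : ellipse R) (z : R[i]) :
  ellipse_inside E z -> `|unit_coord E z| < 1.
Proof.
rewrite /ellipse_inside /= -ltcR => h.
by rewrite -(@expr_lt1 _ 2) // -add_Re2_Im2.
Qed.

(** The form [c + u z + v / z], with [z] on the unit circle, is preserved by real affine maps; in
    contrast to [ellipse_point], no principal axes of the image have to be found. *)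
Lemma unit_coord_ellipse (R : realType) (E E' : ellipse R) :
  exists c u v : R[i], forall t,
    unit_coord E (ellipse_point E' t) = c + u * cis t + v * (cis t)^* /\
    unit_linear E (ellipse_velocity E' t) = 'i * (u * cis t - v * (cis t)^*).
Proof.
have [P [Q h]] := unit_linearE E.
pose p : R[i] := ((semi_a E' + semi_b E') / 2)%:C.
pose q : R[i] := ((semi_a E' - semi_b E') / 2)%:C.
pose w := ellipse_axis E'.
have pJ : p^* = p by exact: conj_real_complex.
have qJ : q^* = q by exact: conj_real_complex.
have iJ : ('i : R[i])^* = - 'i by exact: conjCi.
exists (P * (ellipse_center E' - ellipse_center E) +
        Q * (ellipse_center E' - ellipse_center E)^*).
exists (P * w * p + Q * w^* * q), (P * w * q + Q * w^* * p) => t.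
rewrite /unit_coord !h ellipse_pointE ellipse_velocityE -/p -/q -/w; split.
- rewrite !(rmorphB, rmorphD, rmorphM) /= pJ qJ conjCK; ring.
- rewrite !(rmorphB, rmorphD, rmorphM) /= pJ qJ iJ conjCK; ring.
Qed.

Lemma tangent_line_unit (R : realType) (E E' : ellipse R) (c u v : R[i]) (s t : R) :
  ~ degenerate E ->
  (forall t, unit_coord E (ellipse_point E' t) = c + u * cis t + v * (cis t)^* /\
    unit_linear E (ellipse_velocity E' t) = 'i * (u * cis t - v * (cis t)^*)) ->
  tangent_line E' (ellipse_point E s) (ellipse_point E t) ->
  (cis s + cis t - c - cis s * cis t * c^*) ^+ 2 =
    4 * (u + cis s * cis t * v^*) * (v + cis s * cis t * u^*).
Proof.
move=> nE huv [x [r [k [h1 h2]]]].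
have [P [Q h]] := unit_linearE E.
have [] := huv x; rewrite h1 h2 => h3 h4.
have hB : unit_linear E (ellipse_point E t - ellipse_point E s) = cis t - cis s.
  rewrite -(unit_coord_point t nE) -(unit_coord_point s nE) /unit_coord !h.
  by rewrite !rmorphB /=; ring.
have hk (m : R) (d : R[i]) : unit_linear E (m%:C * d) = m%:C * unit_linear E d.
  by rewrite !h rmorphM /= conj_real_complex; ring.
have e1 : c + u * cis x + v * (cis x)^* = cis s + r%:C * (cis t - cis s).
  rewrite -h3 -hB -hk -(unit_coord_point s nE) /unit_coord !h.
  by rewrite !(rmorphB, rmorphD) /=; ring.
have e2 : 'i * (u * cis x - v * (cis x)^*) = k%:C * (cis t - cis s).
  by rewrite -h4 hk hB.
apply: (@chord_tangentP _ 'i c u v c^* u^* v^* (cis s) (cis t)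
  (cis s)^* (cis t)^* (cis x) (cis x)^* r%:C k%:C) => //.
- exact: neq0Ci.
- exact: mulcis_conj.
- exact: mulcis_conj.
- exact: mulcis_conj.
- move: (congr1 Num.conj e1); rewrite !(rmorphB, rmorphD, rmorphM) /=.
  by rewrite !conj_real_complex ?conjCK.
- have iJ : ('i : R[i])^* = - 'i by exact: conjCi.
  move: (congr1 Num.conj e2); rewrite !(rmorphB, rmorphD, rmorphM) /= iJ.
  by rewrite !conj_real_complex ?conjCK.
Qed.

(** * Vertices of the Poncelet triangles *)

(** The focus [c + 2 * w] lies on the major axis, between two antipodal points [c + d] and [c - d]
    of the curve, so convexity of the open disc applies. *)
Lemma focus_norm_lt1 (R : realType) (c u v w : R[i]) : w ^+ 2 = u * v ->
  (forall t, `|c + u * cis t + v * (cis t)^*| < 1) -> `|c + 2 * w| < 1.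
Proof.
move=> hw hc.
suff [d [k [k0 k1 wE [h1 h2]]]] : exists d : R[i], exists k : R,
    [/\ -1 <= k, k <= 1, 2 * w = k%:C * d & `|c + d| < 1 /\ `|c - d| < 1].
  have -> : c + 2 * w = ((1 + k) / 2)%:C * (c + d) + ((1 - k) / 2)%:C * (c - d).
    rewrite wE !(rmorphM, rmorphD, rmorphB, rmorph1) fmorphV /= rmorphD rmorph1.
    by field.
  have a0 : 0 <= (1 + k) / 2 by lra.
  have b0 : 0 <= (1 - k) / 2 by lra.
  apply: le_lt_trans (ler_normD _ _) _.
  rewrite !normrM [X in X * _ + _]ger0_norm ?ler0c //.
  rewrite [X in _ + X * _]ger0_norm ?ler0c //.
  move: h1 h2; rewrite !normc_def -!rmorphM -rmorphD /= !ltcR.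
  move: (Num.sqrt _) (Num.sqrt _) => m n n1 m1.
  have [|/ltW] := leP m n; rewrite -subr_ge0 => mn.
  - by have := mulr_ge0 a0 mn; have := mulr_ge0 b0 mn; lra.
  - by have := mulr_ge0 a0 mn; have := mulr_ge0 b0 mn; lra.
have cispi t : cis (t + pi) = - cis t.
  rewrite cisD /cis cospi sinpi; apply/eqP; rewrite eq_complex /=.
  by apply/andP; split; apply/eqP; ring.
have hcd t : `|c + (u * cis t + v * (cis t)^*)| < 1 /\
             `|c - (u * cis t + v * (cis t)^*)| < 1.
  split; first by rewrite addrA.
  have := hc (t + pi); rewrite cispi rmorphN /=.
  by congr (Num.norm _ < _); ring.
have [w0|w0] := eqVneq w 0.
  exists (u * cis 0 + v * (cis 0)^*), 0.
  by split; rewrite ?lerN10 ?ler01 ?w0 ?mulr0 ?mul0r //; exact: hcd.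
have u0 : u != 0 by apply: contraNneq w0 => u0; rewrite -sqrf_eq0 hw u0 mul0r.
have nu : 0 < `|u| by rewrite normr_gt0.
have nw : 0 < `|w| by rewrite normr_gt0.
have [r rE] : exists r : R, `|u| / `|w| = r%:C.
  by apply/complex_realP/ger0_real/divr_ge0.
have r0 : 0 < r by rewrite -ltcR -rE divr_gt0.
(* For this [t], [u * cis t] is [r w] and [v * (cis t)^*] is [w / r], so the diameter has the
   direction of [w]. The ratio [2 / (r + 1 / r)] is at most 1. *)
have [t tE] : exists t, w / u * (`|u| / `|w|) = cis t.
  apply: cis_surj; rewrite -normCK !normrM !normfV !normr_id.
  by rewrite [X in X ^+ 2](_ : _ = 1) ?expr1n //; field; rewrite !gt_eqF.
exists (u * cis t + v * (cis t)^*), (2 * r / (r ^+ 2 + 1)).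
have r2 : 0 < r ^+ 2 + 1 by rewrite ltr_wpDl ?sqr_ge0.
split; last exact: hcd.
- by rewrite (le_trans (lerN10 _)) // divr_ge0 ?ltW // mulr_gt0.
- by rewrite ler_pdivrMr // mul1r; have := sqr_ge0 (r - 1); nra.
have rC0 : r%:C != 0 by rewrite -rE gt_eqF // divr_gt0.
have rC2 : r%:C ^+ 2 + 1 != 0.
  rewrite -rmorphXn -(rmorph1 (real_complex R)) -rmorphD /= -ltcR in r2 *.
  by rewrite gt_eqF.
have -> : (2 * r / (r ^+ 2 + 1))%:C = 2 * r%:C / (r%:C ^+ 2 + 1) :> R[i].
  by rewrite rmorphM fmorphV rmorphM (rmorphD _ (r ^+ 2)) rmorphXn rmorph1 rmorph_nat.
rewrite -cisV -tE rE; have -> : v = w ^+ 2 / u by rewrite hw mulrC mulKf.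
by field; rewrite rC0 rC2 u0 w0.
Qed.

(** A real-valued lift of the argument of [l], as a function of the parameter of one vertex. *)
Definition product_arg (R : realType) (f g : R[i]) (s : R) : R :=
  s + blaschke_arg f s + blaschke_arg g s.

Lemma poncelet_vertices (R : realType) (E E' : ellipse R) : nested E E' ->
  exists f g : R[i], [/\ `|f| < 1, `|g| < 1 & forall T s,
    poncelet_family E E' T -> T i0 = ellipse_point E s ->
    exists s1 s2, [/\ T i1 = ellipse_point E s1, T i2 = ellipse_point E s2,
      cis s * cis s1 * cis s2 = cis (product_arg f g s) &
      cis s + cis s1 + cis s2 = f + g + cis s * cis s1 * cis s2 * (f^* * g^*)]].
Proof.
move=> [nE nE' EE'].
have [c [u [v huv]]] := unit_coord_ellipse E E'.
have hc t : `|c + u * cis t + v * (cis t)^*| < 1.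
  by rewrite -(huv t).1; apply/norm_unit_coord/EE'; exists t.
pose w := sqrtC (u * v); have hw : w ^+ 2 = u * v by exact: sqrtCK.
have hwJ : w^* ^+ 2 = u^* * v^* by rewrite -rmorphXn /= hw rmorphM.
(* The foci of the image of [E'], which are not the images of its foci.       *)
pose f := c + 2 * w; pose g := c - 2 * w.
have fJ : f^* = c^* + 2 * w^* by rewrite rmorphD rmorphM /= rmorph_nat.
have gJ : g^* = c^* - 2 * w^* by rewrite rmorphB rmorphM /= rmorph_nat.
have f1 : `|f| < 1 by exact: focus_norm_lt1 hc.
have g1 : `|g| < 1.
  by rewrite /g -mulrN; apply: focus_norm_lt1 hc; rewrite sqrrN.
exists f, g; split => // T s [tT TE Ttan] T0.
have [s1 _ T1] := TE i1; have [s2 _ T2] := TE i2.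
have rel i j a b : i != j -> T i = ellipse_point E a -> T j = ellipse_point E b ->
    (cis a + cis b - c - cis a * cis b * c^*) ^+ 2 =
    4 * (u + cis a * cis b * v^*) * (v + cis a * cis b * u^*).
  by move=> ij Ti Tj; apply: (tangent_line_unit nE huv); rewrite -Ti -Tj; exact: Ttan.
have neq i j a b : i != j -> T i = ellipse_point E a -> T j = ellipse_point E b ->
    cis a != cis b.
  move=> ij Ti Tj; apply: contra_neq ij => ab; apply: (triangle_inj tT).
  by rewrite Ti Tj; exact: eq_cis_point.
have n01 : cis s != cis s1 by exact: (@neq i0 i1).
have n02 : cis s != cis s2 by exact: (@neq i0 i2).
have n12 : cis s1 != cis s2 by exact: (@neq i1 i2).
exists s1, s2; split => //.
(* Both sides factor through the foci, so the product of the other two vertices is a product of two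
   Blaschke factors of [cis s]. *)
- have := tangent_chords_product n12 (@rel i0 i1 _ _ isT T0 (esym T1))
    (@rel i0 i2 _ _ isT T0 (esym T2)).
  have -> : (cis s - c) ^+ 2 - 4 * u * v = (cis s - f) * (cis s - g).
    by rewrite -mulrA -hw /f /g; ring.
  have -> : (1 - cis s * c^*) ^+ 2 - 4 * cis s ^+ 2 * u^* * v^* =
      (1 - f^* * cis s) * (1 - g^* * cis s).
    by rewrite -[4 * _ * _ * _]mulrA -hwJ fJ gJ; ring.
  rewrite !blaschke_argE // => h.
  have nz h' : `|h'| < 1 -> 1 - h'^* * cis s != 0.
    move=> /Re_blaschke_gt0 => /(_ s) h0; apply: contraTneq h0 => ->.
    by rewrite ltxx.
  rewrite /product_arg (cisD (s + blaschke_arg f s)) (cisD s) -mulrA -mulrA; congr (_ * _).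
  apply: (mulIf (mulf_neq0 (nz _ f1) (nz _ g1))); rewrite -h; ring.
- rewrite (@poncelet_vertex_sum _ c u v c^* u^* v^*) ?cis_neq0 //; last first.
    move=> x y; rewrite !inE => /or3P[] /eqP -> /or3P[] /eqP ->; rewrite ?eqxx // => _.
    + exact: (@rel i0 i1).
    + exact: (@rel i0 i2).
    + exact: (@rel i1 i0).
    + exact: (@rel i1 i2).
    + exact: (@rel i2 i0).
    + exact: (@rel i2 i1).
  by rewrite -[4 * _ * _]mulrA -hwJ fJ gJ /f /g; ring.
Qed.

(** * The centers as trigonometric polynomials in [l] *)

Lemma barycenter_trig (R : realType) (E : ellipse R) (f g : R[i]) :
  exists A B C : R[i], forall T s s1 s2 l,
    T i0 = ellipse_point E s -> T i1 = ellipse_point E s1 ->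
    T i2 = ellipse_point E s2 -> l * l^* = 1 ->
    cis s + cis s1 + cis s2 = f + g + l * (f^* * g^*) ->
    barycenter T = A + B * l + C * l^*.
Proof.
pose p : R[i] := ((semi_a E + semi_b E) / 2)%:C.
pose q : R[i] := ((semi_a E - semi_b E) / 2)%:C.
pose w := ellipse_axis E.
exists (ellipse_center E + w / 3 * (p * (f + g) + q * (f + g)^*)).
exists (w / 3 * p * (f^* * g^*)), (w / 3 * q * (f * g)).
move=> T s s1 s2 l T0 T1 T2 ll hs.
rewrite /barycenter !big_ord_recl big_ord0 addr0 T0 T1 T2 !ellipse_pointE -/p -/q -/w.
have hsJ : (cis s)^* + (cis s1)^* + (cis s2)^* = (f + g)^* + l^* * (f * g).
  by rewrite -!rmorphD hs rmorphD !rmorphM /= !conjCK.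
transitivity (ellipse_center E + w / 3 * (p * (cis s + cis s1 + cis s2) +
    q * ((cis s)^* + (cis s1)^* + (cis s2)^*))); first by field.
by rewrite hs hsJ; field.
Qed.

(** For the circumcenter [y] in the frame of the axes of [E], [circumcenter_relation] gives
    [p * y^* + q * y]. Together with the conjugate relation this is a linear system of determinant
    [p ^+ 2 - q ^+ 2], the product of the semi-axes. *)
Lemma circumcenter_trig (R : realType) (E : ellipse R) (f g : R[i]) :
  ~ degenerate E ->
  exists A B C : R[i], forall T s s1 s2 l,
    is_triangle T ->
    T i0 = ellipse_point E s -> T i1 = ellipse_point E s1 ->
    T i2 = ellipse_point E s2 -> l = cis s * cis s1 * cis s2 ->
    cis s + cis s1 + cis s2 = f + g + l * (f^* * g^*) ->
    circumcenter T = A + B * l + C * l^*.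
Proof.
move=> nE; have [a0 b0] := nondegenerateP nE.
pose pr := (semi_a E + semi_b E) / 2; pose qr := (semi_a E - semi_b E) / 2.
pose p : R[i] := pr%:C; pose q : R[i] := qr%:C.
pose w := ellipse_axis E.
have pJ : p^* = p by exact: conj_real_complex.
have qJ : q^* = q by exact: conj_real_complex.
have d0 : p ^+ 2 - q ^+ 2 != 0.
  have -> : p ^+ 2 - q ^+ 2 = (semi_a E * semi_b E)%:C.
    by rewrite -!rmorphXn -rmorphB; congr (_%:C); rewrite /pr /qr; field.
  by rewrite (_ : 0 = 0%:C) // (inj_eq (@complexI _)) mulf_neq0 // gt_eqF.
pose k := w * (p * q) / (p ^+ 2 - q ^+ 2).
exists (ellipse_center E + k * (p * (f + g)^* - q * (f + g))).
exists (k * (p - q * (f^* * g^*))), (k * (p * (f * g) - q)).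
move=> T s s1 s2 l tT T0 T1 T2 hl hs.
have nz := axis_neq0 E.
have ll : l * l^* = 1.
  by rewrite hl !rmorphM mulrACA mulcis_conj mulr1 mulrACA !mulcis_conj mulr1.
have [y TO] : exists y, circumcenter T = ellipse_center E + w * y.
  by exists ((circumcenter T - ellipse_center E) / w); rewrite /w; field.
have neq i j a b : i != j -> T i = ellipse_point E a -> T j = ellipse_point E b ->
    cis a != cis b.
  move=> ij Ti Tj; apply: contra_neq ij => ab; apply: (triangle_inj tT).
  by rewrite Ti Tj; exact: eq_cis_point.
have onE i a : T i = ellipse_point E a ->
    `|circumcenter T - T i| = `|p * cis a + q / cis a - y|.
  move=> ->; rewrite ellipse_pointE -/pr -/qr -/p -/q -/w.
  rewrite -[RHS]mul1r -(axis_norm1 E) -normrM -normrN; congr Num.norm.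
  by rewrite cisV TO -/w; ring.
have h : p * y^* + q * y = p * q * (cis s + cis s1 + cis s2 + l^-1).
  rewrite hl; apply: (@circumcenter_relation _ _ _ _ _ (`|circumcenter T - T i0| ^+ 2));
    rewrite ?cis_neq0 //.
  - exact: (@neq i0 i1).
  - exact: (@neq i0 i2).
  - exact: (@neq i1 i2).
  have on a i : T i = ellipse_point E a ->
      (p * cis a + q / cis a - y) * (p / cis a + q * cis a - y^*) =
      `|circumcenter T - T i0| ^+ 2.
    move=> Ti; rewrite (circumcenterP tT i0 i) (onE _ _ Ti) normCK; congr (_ * _).
    by rewrite !cisV rmorphB rmorphD !rmorphM /= pJ qJ conjCK.
  by move=> z; rewrite !inE => /or3P[] /eqP ->; [exact: on T0|exact: on T1|exact: on T2].
have lV : l^-1 = l^* by apply: (@mulfI _ l); rewrite ?ll ?divff //;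
  apply: contra_eq_neq ll => ->; rewrite mul0r eq_sym oner_eq0.
have hsJ : (cis s + cis s1 + cis s2)^* = (f + g)^* + l^* * (f * g).
  by rewrite hs rmorphD !rmorphM /= !conjCK.
have hJ : p * y + q * y^* = p * q * ((cis s + cis s1 + cis s2)^* + l).
  have := congr1 Num.conj h; rewrite lV.
  by rewrite rmorphD !rmorphM rmorphD /= pJ qJ !conjCK.
have yE : y = (p * (p * y + q * y^*) - q * (p * y^* + q * y)) / (p ^+ 2 - q ^+ 2).
  by field.
by rewrite TO yE h hJ hsJ hs lV /k; field.
Qed.

(* Multiplied by [l ^+ 2], the equation [|A + B l + C / l| ^+ 2 = 1] is       *)
(* polynomial of degree at most 4.                                            *)
Lemma trig_on_circle (R : realType) (A B C : R[i]) (ls : seq R[i]) :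
  uniq ls -> size ls = 5 ->
  (forall l, l \in ls -> l * l^* = 1 /\
    (A + B * l + C * l^*) * (A + B * l + C * l^*)^* = 1) ->
  [\/ B = 0 /\ C = 0, [/\ A = 0, C = 0 & B * B^* = 1] |
      [/\ A = 0, B = 0 & C * C^* = 1]].
Proof.
move=> uls sls h.
pose P : {poly R[i]} := Poly [:: C * B^*; A * B^* + C * A^*;
  A * A^* + B * B^* + C * C^* - 1; A * C^* + B * A^*; B * C^*].
have P0 : P = 0.
  apply: (@roots_geq_poly_eq0 _ _ ls) => //; last first.
    by rewrite sls (leq_trans (size_Poly _)).
  apply/allP => l /h [ll hl]; apply/rootP.
  rewrite horner_Poly /= mul0r add0r.
  transitivity (l ^+ 2 * ((A + B * l + C * l^*) * (A + B * l + C * l^*)^* - 1)).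
    have l0 : l != 0.
      by apply: contra_eq_neq ll => ->; rewrite mul0r eq_sym oner_eq0.
    have lV : l^* = l^-1 by apply: (mulfI l0); rewrite ll divff.
    by rewrite !rmorphD !rmorphM /= conjCK lV; field.
  by rewrite hl subrr mulr0.
have coef i : P`_i = 0 by rewrite P0 coef0.
(* The coefficients 0 and 1 are the conjugates of the coefficients 4 and 3. *)
have c2 := coef 2; have c3 := coef 3; have c4 := coef 4.
rewrite /P !coef_Poly /= in c2 c3 c4.
move/eqP: c4; rewrite mulf_eq0 conjC_eq0 => /orP[] /eqP z0.
- move/eqP: c3; rewrite z0 mul0r addr0 mulf_eq0 conjC_eq0 => /orP[] /eqP z1.
  + apply: Or33; split => //; apply/eqP; rewrite -subr_eq0 -c2 z0 z1.
    by rewrite !mul0r !add0r.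
  + by apply: Or31.
- move/eqP: c3; rewrite z0 rmorph0 mulr0 add0r mulf_eq0 conjC_eq0 => /orP[] /eqP z1.
  + by apply: Or31.
  + apply: Or32; split => //; apply/eqP; rewrite -subr_eq0 -c2 z0 z1.
    by rewrite !mul0r !add0r addr0.
Qed.

Lemma locus_trig (R : realType) (E E' : ellipse R) (Xk : vertices R -> R[i])
    (alpha beta gamma : R[i]) (X : vertices R -> R[i]) :
  nested E E' -> (exists T, poncelet_family E E' T) -> stationary E E' Xk ->
  (forall T, X T = alpha * barycenter T + beta * circumcenter T + gamma * Xk T) ->
  exists f g A B C : R[i], [/\ `|f| < 1, `|g| < 1 & forall T s,
    poncelet_family E E' T -> T i0 = ellipse_point E s ->
    X T = A + B * cis (product_arg f g s) + C * (cis (product_arg f g s))^*].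
Proof.
move=> nEE [T1 hT1] stat hX.
have [f [g [f1 g1 hfg]]] := poncelet_vertices nEE.
have nE : ~ degenerate E by case: nEE.
have [Ab [Bb [Cb hb]]] := barycenter_trig E f g.
have [Ac [Bc [Cc hc]]] := circumcenter_trig f g nE.
exists f, g, (alpha * Ab + beta * Ac + gamma * Xk T1).
exists (alpha * Bb + beta * Bc), (alpha * Cb + beta * Cc); split => // T s hT Ts.
have [s1 [s2 [Ts1 Ts2 hl hs]]] := hfg T s hT Ts.
have tT : is_triangle T by case: hT.
rewrite hl in hs.
rewrite hX (stat _ _ hT hT1) (hb _ _ _ _ _ Ts Ts1 Ts2 (mulcis_conj _) hs).
by rewrite (hc _ _ _ _ _ tT Ts Ts1 Ts2 (esym hl) hs); ring.
Qed.

(** * Monotone motion *)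

Lemma product_arg_lt (R : realType) (f g : R[i]) : `|f| < 1 -> `|g| < 1 ->
  {homo product_arg f g : s t / s < t}.
Proof.
move=> f1 g1 s t st; apply: ltrD; last exact: blaschke_arg_lt.
by apply: ltrD => //; exact: blaschke_arg_lt.
Qed.

Lemma product_arg_continuous (R : realType) (f g : R[i]) : `|f| < 1 -> `|g| < 1 ->
  continuous (product_arg f g).
Proof.
move=> f1 g1 x; apply: cvgD; last exact: blaschke_arg_continuous.
by apply: cvgD; [exact: cvg_id|exact: blaschke_arg_continuous].
Qed.

Lemma moves_monotonically_comp (R : realType) (I : interval R)
    (P Q : R -> R[i]) (E L : ellipse R) (Phi : R -> R) :
  continuous Phi ->
  {homo Phi : s t / s < t} \/ {homo Phi : s t /~ s < t} ->
  (forall t s, t \in I -> P t = ellipse_point E s -> Q t = ellipse_point L (Phi s)) ->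
  moves_monotonically I P E -> moves_monotonically I Q L.
Proof.
move=> cPhi mPhi hPQ [theta [ctheta mtheta hP]].
exists (Phi \o theta); split; last by move=> t tI; apply: hPQ (hP t tI).
- by move=> x; apply: (continuous_comp (ctheta x)); exact: cPhi.
- by case: mPhi mtheta => m [] n; [left|right|right|left] => s t sI tI /n st; apply/m/st.
Qed.

Theorem proposition1 (R : realType) (E E' : ellipse R)
    (hnested : nested E E')
    (hponcelet : exists T, poncelet_family E E' T)
    (Xk : vertices R -> R[i])
    (hcenter : triangle_center Xk)
    (hstationary : stationary E E' Xk)
    (alpha beta gamma : R[i])
    (X : vertices R -> R[i])
    (hX : forall T, X T =
      alpha * barycenter T + beta * circumcenter T + gamma * Xk T)
    (L : ellipse R)
    (hlocus : locus E E' X = ellipse_curve L)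
    (hL : ~ degenerate L)
    (I : interval R)
    (T : R -> vertices R)
    (hT : {in I, forall t, poncelet_family E E' (T t)})
    (hsweep : forall i, moves_monotonically I (fun t => T t i) E) :
  moves_monotonically I (fun t => X (T t)) L.
Proof.
have [f [g [A [B [C [f1 g1 hABC]]]]]] :=
  locus_trig hnested hponcelet hstationary hX.
have [P [Q hPQ]] := unit_linearE L.
(* Coefficients of [X] in the coordinates where [L] is the unit circle; the conjugate-linear part
   [Q] exchanges the roles of [l] and [l^*]. *)
pose A' := P * (A - ellipse_center L) + Q * (A - ellipse_center L)^*.
pose B' := P * B + Q * C^*; pose C' := P * C + Q * B^*.
have coordE T1 s : poncelet_family E E' T1 -> T1 i0 = ellipse_point E s ->
    unit_coord L (X T1) = A' + B' * cis (product_arg f g s) +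
      C' * (cis (product_arg f g s))^*.
  move=> hT1 Ts; rewrite (hABC _ _ hT1 Ts) /unit_coord hPQ.
  by rewrite !(rmorphB, rmorphD, rmorphM) /= conjCK /A' /B' /C' rmorphB /=; ring.
have point_coord T1 s : poncelet_family E E' T1 -> unit_coord L (X T1) = cis s ->
    X T1 = ellipse_point L s.
  move=> hT1 hs; have : ellipse_curve L (X T1) by rewrite -hlocus; exists T1.
  by move=> [s' _ hs']; rewrite -hs' unit_coord_point // in hs *; exact: eq_cis_point.
(* Since the locus is all of [L], its points of abscissa [n.+1%:R^-1] in unit coordinates are
   attained. Their being distinct provides the five distinct values of [l] that exceed the degree
   4. *)
have /choice[phi hphi] (n : nat) : exists phi : R,
    A' + B' * cis phi + C' * (cis phi)^* = cis (acos (n.+1%:R^-1)).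
  have : locus E E' X (ellipse_point L (acos (n.+1%:R^-1))).
    by rewrite hlocus; exists (acos n.+1%:R^-1).
  move=> [T1 hT1 XT1]; have [_ /(_ i0) [s _ /esym Ts] _] := hT1.
  by exists (product_arg f g s); rewrite -(coordE T1) // XT1 unit_coord_point.
have phi_inj m n : A' + B' * cis (phi m) + C' * (cis (phi m))^* =
    A' + B' * cis (phi n) + C' * (cis (phi n))^* -> m = n.
  have cosa k : cos (acos (k.+1%:R^-1 : R)) = k.+1%:R^-1.
    rewrite acosK // in_itv /= invf_le1 ?ltr0n // ler1n andbT.
    by rewrite (le_trans (lerN10 _)) ?invr_ge0.
  rewrite !hphi => -[]; rewrite !cosa => /invr_inj /eqP.
  by rewrite eqr_nat eqSS => /eqP.
have [] := @trig_on_circle R A' B' C' [seq cis (phi n) | n <- iota 0 5].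
- rewrite map_inj_uniq ?iota_uniq // => m n mn.
  by apply: phi_inj; rewrite mn.
- by rewrite size_map size_iota.
- by move=> l /mapP[n _ ->]; rewrite hphi !mulcis_conj.
(* A constant polynomial would identify the points of index 0 and 1. *)
- move=> [B0 C0]; have : 0%N = 1%N by apply: phi_inj; rewrite B0 C0 !mul0r.
  by [].
(* [X] has angle [d] plus the argument of [l], and turns in the sense of the vertices. *)
- move=> [A0 C0 /cis_surj[d Bd]].
  apply: (@moves_monotonically_comp _ _ _ _ _ _
    (fun s => d + product_arg f g s)) (hsweep i0) => [x|| t s tI Ts].
  + by apply: cvgD; [exact: cvg_cst|exact: product_arg_continuous].
  + by left => s t st; rewrite ltrD2l; apply: product_arg_lt.
  + apply: point_coord; first exact: hT.
    by rewrite (coordE _ _ (hT _ tI) Ts) A0 C0 Bd cisD; ring.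
(* [X] has angle [d] minus the argument of [l], and its parameter on [L] runs opposite to that of
   the vertices on [E]. *)
- move=> [A0 B0 /cis_surj[d Cd]].
  apply: (@moves_monotonically_comp _ _ _ _ _ _
    (fun s => d - product_arg f g s)) (hsweep i0) => [x|| t s tI Ts].
  + by apply: cvgB; [exact: cvg_cst|exact: product_arg_continuous].
  + by right => s t st; rewrite ltrD2l ltrN2; apply: product_arg_lt.
  + apply: point_coord; first exact: hT.
    by rewrite (coordE _ _ (hT _ tI) Ts) A0 B0 Cd cisD -cis_conj; ring.
Qed.
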